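(* Let $K$ be a complete discretely valued field with uniformizer $\pi$ and residue field of characteristic different from $2$, and let $D=\left(\frac{a,\pi}{K}\right)$ be a quaternion division algebra over $K$ with $a\in\mathcal{O}_K^*$, with $K$-basis $1,x,y,z$ where $x^2=a$, $y^2=\pi$, $z=xy=-yx$. Let $\sigma\in\{\tau,\tau_x,\tau_y\}$, $\epsilon\in\{1,-1\}$, and let $\delta,\alpha,\beta,\gamma\in\mathcal{O}_K$ be such that $u=\delta+\alpha x+\beta y+\gamma z$ satisfies $\sigma(u)=\epsilon u$ and $\nu_D(u)=0$; let $h=\langle u\rangle$, a one-dimensional unramified $\epsilon$-hermitian form over $(D,\sigma)$. Then: (1) If $\sigma=\tau$ and $\epsilon=1$, then $h\cong\langle\delta\rangle$ and $\delta\in\mathcal{O}_K^*$. (2) If $\sigma=\tau$ and $\epsilon=-1$, then $h\cong\langle\alpha x\rangle$ and $\alpha\in\mathcal{O}_K^*$. (3) If $\sigma=\tau_x$ and $\epsilon=1$, then $h\cong\langle\delta\rangle$ and $\delta\in\mathcal{O}_K^*$. (4) If $\sigma=\tau_x$ and $\epsilon=-1$, then $h\cong\langle\alpha x\rangle$ and $\alpha\in\mathcal{O}_K^*$. (5) If $\sigma=\tau_y$, then necessarily $\epsilon=1$, $h\cong\langle\delta+\alpha x\rangle$, and $\delta+\alpha x$ is a unit (of the valuation ring) of the field $K(x)$.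
   Context: $\mathcal{O}_K$ is the valuation ring of the normalized valuation $\nu_K$ of $K$. $\nu_D(d)=\frac12\nu_K(\mathrm{Nrd}(d))$ for $d\in D\setminus\{0\}$ is the extension of $\nu_K$ to $D$. $\tau$ is the canonical (symplectic) involution of $D$: $\tau(x)=-x$, $\tau(y)=-y$, $\tau(z)=-z$. For $\lambda\in\{x,y\}$, $\tau_\lambda(d)=\lambda\tau(d)\lambda^{-1}$. For $u\in D^*$ with $\sigma(u)=\epsilon u$, $\langle u\rangle$ is the one-dimensional $\epsilon$-hermitian form $(d,d')\mapsto\sigma(d)ud'$ on $D$; thus $\langle u\rangle\cong\langle v\rangle$ iff $v=\sigma(t)ut$ for some $t\in D^*$. *)

(* Defs.v *)
From HB Require Import structures.
From mathcomp Require Import all_boot all_order all_algebra all_field.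

Set Implicit Arguments.
Unset Strict Implicit.
Unset Printing Implicit Defensive.

Import Order.TTheory GRing.Theory Num.Theory.
Local Open Scope ring_scope.
Local Open Scope quotient_scope.

(* The value at 0, which should be +oo, is left unspecified: every use of a
   valuation below treats 0 separately. *)
Record discrete_valuation (K : fieldType) := DiscreteValuation {
  dval :> K -> int;
  dvalM : forall c d, c != 0 -> d != 0 -> dval (c * d) = dval c + dval d;
  dvalD : forall c d, c != 0 -> d != 0 -> c + d != 0 ->
    Order.min (dval c) (dval d) <= dval (c + d);
  dval_surj : forall n : int, exists2 c, c != 0 & dval c = n
}.

Definition units_in (R : unitRingType) (S : {pred R}) : {pred R} :=
  [pred c | [&& c \in S, c \is a GRing.unit & c^-1 \in S]].

Section Valuation.
Variables (K : fieldType) (v : discrete_valuation K).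

Definition vint : {pred K} := [pred c | (c == 0) || (0 <= v c)].

Definition uniformizer (p : K) : Prop := p != 0 /\ v p = 1.

Definition val_close (N : int) (c d : K) : Prop := c = d \/ N <= v (c - d).

Definition val_complete : Prop :=
  forall s : nat -> K,
    (forall N : int, exists n0 : nat, forall m n : nat,
       (n0 <= m)%N -> (n0 <= n)%N -> val_close N (s m) (s n)) ->
    exists l : K, forall N : int, exists n0 : nat, forall n : nat,
       (n0 <= n)%N -> val_close N (s n) l.

Lemma dval1 : v 1 = 0.
Proof.
have := dvalM v (oner_neq0 K) (oner_neq0 K); rewrite mulr1 => /eqP.
by rewrite -[X in X == _]addr0 (inj_eq (addrI _)) eq_sym => /eqP.
Qed.

Lemma dvalN c : v (- c) = v c.
Proof.
have [->|c0] := eqVneq c 0; first by rewrite oppr0.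
have N10 : (-1 : K) != 0 by rewrite oppr_eq0 oner_neq0.
have := dvalM v N10 N10; rewrite mulrNN mulr1 dval1 => /eqP.
rewrite eq_sym -mulr2n mulrn_eq0 /= => /eqP vN1.
by rewrite -mulN1r (dvalM v N10 c0) vN1 add0r.
Qed.

Lemma vint_subring_closed : subring_closed vint.
Proof.
split=> [|c d|c d]; first by rewrite inE dval1 lexx orbT.
- rewrite !inE; have [->|c0] /= := eqVneq c 0; first by rewrite sub0r oppr_eq0 dvalN.
  move=> vc; have [->|d0] /= := eqVneq d 0; first by rewrite subr0 vc orbT.
  move=> vd; have [//|cd0] /= := eqVneq (c - d) 0.
  have Nd0 : - d != 0 by rewrite oppr_eq0.
  apply: (le_trans _ (dvalD v c0 Nd0 cd0)).
  by rewrite dvalN le_min vc vd.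
- rewrite !inE; have [->|c0] /= := eqVneq c 0; first by rewrite mul0r eqxx.
  move=> vc; have [->|d0] /= := eqVneq d 0; first by rewrite mulr0 eqxx.
  by move=> vd; rewrite (dvalM v c0 d0) addr_ge0 // orbT.
Qed.

HB.instance Definition _ := GRing.isSubringClosed.Build K vint vint_subring_closed.

Record val_ring := ValRing { val_ring_val :> K; _ : val_ring_val \in vint }.

HB.instance Definition _ := [isSub for val_ring_val].
HB.instance Definition _ := [Choice of val_ring by <:].
HB.instance Definition _ := [SubChoice_isSubComNzRing of val_ring by <:].

Definition max_ideal : {pred val_ring} :=
  [pred c : val_ring | (val c == 0) || (0 < v (val c))].

Lemma max_ideal_idealr_closed : idealr_closed max_ideal.
Proof.
have V0 : val (0 : val_ring) = 0 by [].
have V1 : val (1 : val_ring) = 1 by [].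
have VDM (e c d : val_ring) : val (e * c + d) = val e * val c + val d by [].
split=> [||e c d]; first by rewrite inE V0 eqxx.
  by rewrite inE V1 oner_eq0 dval1 ltxx.
rewrite !inE VDM; move: (valP e) (val c) (val d); rewrite inE.
move: (val e) => {}e ie {}c {}d; move: ie.
have [->|e0] /= := eqVneq e 0; first by rewrite mul0r add0r.
move=> ve; have [->|c0] /= := eqVneq c 0; first by rewrite mulr0 add0r.
move=> vc; have ec0 : e * c != 0 by rewrite mulf_neq0.
have vec : 0 < v (e * c) by rewrite (dvalM v e0 c0) ltr_wpDl.
have [->|d0] /= := eqVneq d 0; first by rewrite addr0 vec orbT.
move=> vd; have [//|s0] /= := eqVneq (e * c + d) 0.
by apply: (lt_le_trans _ (dvalD v ec0 d0 s0)); rewrite lt_min vec vd.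
Qed.

HB.instance Definition _ :=
  isIdealr.Build val_ring max_ideal max_ideal_idealr_closed.

Definition residue_field := {ideal_quot max_ideal}.

Lemma residue_field_inv (r : residue_field) : r != 0 -> exists s, r * s = 1.
Proof.
elim/quotW: r => c.
have -> : (0 : residue_field) = \pi 0%R by rewrite pi_zeror.
rewrite -Quotient.idealrBE subr0 inE negb_or -leNgt => /andP[c0 vc].
have vc0 : v (val c) = 0.
  by apply/le_anti; rewrite vc /=; move: (valP c); rewrite inE (negbTE c0).
have ci : (val c)^-1 \in vint.
  rewrite inE invr_eq0 (negbTE c0) /=.
  have := dvalM v c0 (invr_neq0 c0).
  by rewrite mulfV // dval1 vc0 add0r => <-.
exists (\pi_{ideal_quot max_ideal} (ValRing ci)).
rewrite -pi_mulr -pi_oner; congr (\pi _).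
by apply: val_inj; rewrite /= mulfV.
Qed.

End Valuation.

Section Quaternion.
Variables (K : fieldType) (D : falgType K).

Definition quaternion_basis (a b : K) (x y z : D) : Prop :=
  [/\ x ^+ 2 = a%:A, y ^+ 2 = b%:A, z = x * y, z = - (y * x)
    & basis_of {:D} [:: 1; x; y; z]].

Definition division_algebra : Prop := forall d : D, d != 0 -> d \is a GRing.unit.

Variables x y z : D.

Definition qcoord (i : 'I_4) (d : D) : K := coord [tuple 1; x; y; z] i d.

Definition canonical_inv (d : D) : D :=
  qcoord 0 d *: 1 - qcoord 1 d *: x - qcoord 2 d *: y - qcoord 3 d *: z.

Definition twisted_inv (lam d : D) : D := lam * canonical_inv d * lam^-1.

(* d * canonical_inv d is a scalar (see canonical_inv_norm), so that its coordinate
   along 1 is the reduced norm. *)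
Definition Nrd (d : D) : K := qcoord 0 (d * canonical_inv d).

Variable v : discrete_valuation K.

(* As for v, the value at 0 is meaningless. *)
Definition nuD (d : D) : rat := (v (Nrd d))%:~R / 2.

Definition Kx_vint : {pred D} :=
  [pred w : D | (w \in <<1; x>>%VS) && ((w == 0) || (0 <= nuD w))].

End Quaternion.

Section Hermitian.
Variables (K : fieldType) (D : falgType K) (sigma : D -> D).

Definition herm1 (u : D) : D -> D -> D := fun d d' => sigma d * u * d'.

(* D is regarded as a right module over itself. *)
Definition isometric (h h' : D -> D -> D) : Prop :=
  exists f : D -> D,
    [/\ forall d e, f (d + e) = f d + f e,
        forall d e, f (d * e) = f d * e,
        bijective f
      & forall d e, h' (f d) (f e) = h d e].

Lemma isometric_herm1 (u w : D) :
    sigma 1 = 1 -> (forall d e, sigma (d * e) = sigma e * sigma d) ->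
  isometric (herm1 w) (herm1 u) <->
  exists2 t : D, t \is a GRing.unit & w = sigma t * u * t.
Proof.
move=> s1 sM; split=> [[f [fD fM [g fK gK] fh]]|[t tU ->]].
  have fE d : f d = f 1 * d by rewrite -fM mul1r.
  exists (f 1); last by have := fh 1 1; rewrite /herm1 s1 mul1r mulr1.
  have t1 : f 1 * g 1 = 1 by rewrite -fE gK.
  have t2 : g 1 * f 1 = 1.
    by apply: (can_inj fK); rewrite fE mulrA t1 mul1r.
  by apply/unitrP; exists (g 1).
exists (fun d => t * d); split=> [d e|d e||d e]; rewrite ?mulrDr ?mulrA //.
  by exists (fun d => t^-1 * d) => d; rewrite mulrA ?mulVr ?mulrV ?mul1r.
by rewrite /herm1 sM !mulrA.
Qed.

End Hermitian.

Section QuaternionTheory.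
Variables (K : fieldType) (D : falgType K) (a b : K) (x y z : D).
Hypothesis Q : quaternion_basis a b x y z.

Let quat c0 c1 c2 c3 : D := c0 *: 1 + c1 *: x + c2 *: y + c3 *: z.

Lemma qcoord_quat c0 c1 c2 c3 (i : 'I_4) :
  qcoord x y z i (quat c0 c1 c2 c3) = [:: c0; c1; c2; c3]`_i.
Proof.
case: Q => _ _ _ _ B; rewrite /qcoord.
have -> : quat c0 c1 c2 c3
    = \sum_(j < 4) [:: c0; c1; c2; c3]`_j *: [tuple 1; x; y; z]`_j.
  by rewrite !big_ord_recl big_ord0 /= addr0 !addrA.
by rewrite coord_sum_free // (basis_free B).
Qed.

Lemma canonical_inv_quat c0 c1 c2 c3 :
  canonical_inv x y z (quat c0 c1 c2 c3)
    = quat c0 (- c1) (- c2) (- c3).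
Proof. by rewrite /canonical_inv !qcoord_quat /= /quat !scaleNr. Qed.

Lemma quat_decomp d : exists c0 c1 c2 c3, d = quat c0 c1 c2 c3.
Proof.
case: Q => _ _ _ _ B.
have Bt : basis_of {:D} [tuple 1; x; y; z] by [].
have := coord_basis Bt (memvf d); rewrite !big_ord_recl big_ord0 /= addr0 !addrA => E.
by do 4!eexists; exact: E.
Qed.


Lemma canonical_inv_norm d :
  d * canonical_inv x y z d = (Nrd x y z d)%:A.
Proof.
have [c0 [c1 [c2 [c3 ->]]]] := quat_decomp d.
set p := c1 *: x + c2 *: y + c3 *: z.
have [xx yy zE zE' B] := Q.
have yx : y * x = - z by rewrite zE' opprK.
have xz : x * z = a *: y by rewrite zE mulrA -expr2 xx mulr_algl.
have zx : z * x = - (a *: y).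
  by rewrite {1}zE -mulrA yx mulrN xz.
have zy : z * y = b *: x by rewrite {1}zE -mulrA -expr2 yy mulr_algr.
have yz : y * z = - (b *: x) by rewrite {1}zE mulrA yx mulNr zy.
have zz : z * z = - (a * b)%:A.
  by rewrite {1}zE -mulrA yz mulrN -scalerAr -expr2 xx scalerA mulrC.
pose n := c0 ^+ 2 - (c1 ^+ 2 * a + c2 ^+ 2 * b - c3 ^+ 2 * (a * b)).
have pp : p * p = (c1 ^+ 2 * a + c2 ^+ 2 * b - c3 ^+ 2 * (a * b))%:A.
  have mZ (r s : K) (g h : D) : (r *: g) * (s *: h) = (r * s) *: (g * h).
    by rewrite -scalerAl -scalerAr scalerA.
  rewrite /p !mulrDl !mulrDr !mZ -!expr2 xx yy -zE yx xz zx yz zy.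
  rewrite [z ^+ 2]expr2 zz !scalerN !scalerDl scaleNr !scalerA.
  rewrite [c2 * c1]mulrC [c3 * c1]mulrC [c3 * c2]mulrC.
  set X := (c1 * c2) *: z; set Y := (c1 * c3 * a) *: y.
  set Z := (c2 * c3 * b) *: x.
  set A1 := (c1 ^+ 2 * a)%:A; set A2 := (c2 ^+ 2 * b)%:A.
  set A3 := (c3 ^+ 2 * (a * b))%:A.
  rewrite -[A1 + X + Y + _ + _]/(A1 + X + Y + (- X + A2 - Z) + (- Y + Z - A3)).
  rewrite [LHS](AC (3*3*3) (1*5*9*(2*4)*(3*7)*(6*8)))/=.
  by rewrite !subrr addNr !addr0.
set d' := quat _ _ _ _.
suff E : d' * canonical_inv x y z d' = quat n 0 0 0.
  rewrite /Nrd E /quat (qcoord_quat n 0 0 0 0) !scale0r !addr0 //.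
have -> : canonical_inv x y z d' = c0%:A - p.
  by rewrite canonical_inv_quat /quat !scaleNr /p !opprD !addrA.
have -> : d' = c0%:A + p by rewrite /d' /quat /p !addrA.
clearbody p; rewrite mulrBr !mulrDl pp mulr_algl mulr_algl mulr_algr.
rewrite /quat !scale0r !addr0 opprD addrA addrK scalerA -expr2.
by rewrite /n [RHS]scalerBl.
Qed.

End QuaternionTheory.

(* Main.v *)
Require Import Defs.
From HB Require Import structures.
From mathcomp Require Import all_boot all_order all_algebra all_field.
From mathcomp Require Import ring zify.

Set Implicit Arguments.
Unset Strict Implicit.
Unset Printing Implicit Defensive.

Import Order.TTheory GRing.Theory Num.Theory.
Local Open Scope ring_scope.

(** Write [u = u0 + w] with [u0 = delta + alpha x] in [K(x)] and
    [w = beta y + gamma z] in [K(x) y].  All five cases say that [<u>] is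
    isometric to [<u0>] and that [u0] is a unit: each of the three involutions
    acts on the basis [1, x, y, z] by signs, so the symmetry of [u] gives
    [alpha = 0] in the first and third cases and [delta = 0] in the second and
    fourth.  In the last case it puts no condition on [u0] if [epsilon = 1], and
    it would give [u0 = 0] if [epsilon = -1].

    The decomposition is orthogonal for the reduced norm, and the norm
    [- pi (beta^2 - a gamma^2)] of [w] lies in the maximal ideal; hence the norm
    [delta^2 - a alpha^2] of [u0] is a unit as soon as that of [u] is
    ([vunit_Kx_norm]), and [u0] is a unit of the valuation ring of [K(x)]
    ([Kx_unit]).

    For the isometry, put [e = u0^-1 w], so that [u = u0 (1 + e)].  Since [e]
    lies in [K(x) y], its square is a scalar [q], and [q] is in the maximal ideal.
    Hensel's lemma for squares ([hensel_sqrt], the one use of completeness) gives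
    a square root [t] of [1 + e] in the field [K(e)].  As [sigma] multiplies both [u0] and [w] by [epsilon], one has
    [sigma e * u0 = w = u0 * e], and therefore [sigma t * u0 = u0 * t]; so
    [sigma t * u0 * t = u0 * t^2 = u] ([isometric_mul_sqrt]). *)

(** * Units and square roots in a complete discretely valued field *)

Section Valuation.
Variables (K : fieldType) (v : discrete_valuation K).

(** Membership in the fractional ideal [pi^n O_K]; unlike the bare inequality
    on [v c] it treats [0] correctly, so it is stable under sums. *)
Definition val_ge (n : int) (c : K) : bool := (c == 0) || (n <= v c).

Lemma val_ge0 n : val_ge n 0.
Proof. by rewrite /val_ge eqxx. Qed.

Lemma val_geN n c : val_ge n (- c) = val_ge n c.
Proof. by rewrite /val_ge oppr_eq0 dvalN. Qed.

Lemma val_geD n c d : val_ge n c -> val_ge n d -> val_ge n (c + d).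
Proof.
rewrite /val_ge; have [->|c0] /= := eqVneq c 0; first by rewrite add0r.
have [->|d0] /= := eqVneq d 0; first by rewrite addr0 (negbTE c0).
have [//|cd0] /= := eqVneq (c + d) 0 => vc vd.
by apply: le_trans (dvalD v c0 d0 cd0); rewrite le_min vc.
Qed.

Lemma val_geB n c d : val_ge n c -> val_ge n d -> val_ge n (c - d).
Proof. by move=> vc vd; rewrite val_geD ?val_geN. Qed.

Lemma val_geM m n c d : val_ge m c -> val_ge n d -> val_ge (m + n) (c * d).
Proof.
rewrite /val_ge mulf_eq0; have [//|c0] /= := eqVneq c 0.
by have [//|d0] /= := eqVneq d 0 => vc vd; rewrite dvalM // lerD.
Qed.

Lemma val_geW m n c : m <= n -> val_ge n c -> val_ge m c.
Proof. by rewrite /val_ge => mn /orP[->//|/(le_trans mn) ->]; rewrite orbT. Qed.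

Lemma val_ge_eq0 c : (forall n : nat, val_ge n c) -> c = 0.
Proof.
move=> /(_ (absz (v c)).+1); have [//|_] := eqVneq c 0.
by rewrite /val_ge => /orP[/eqP//|]; lia.
Qed.

Definition vunit (c : K) : bool := (c != 0) && (v c == 0).

Lemma vunit_neq0 c : vunit c -> c != 0.
Proof. by case/andP. Qed.

Lemma vunit_ge0 c : vunit c -> val_ge 0 c.
Proof. by case/andP=> _ /eqP vc; rewrite /val_ge vc lexx orbT. Qed.

Lemma vunit1 : vunit 1.
Proof. by rewrite /vunit oner_neq0 dval1 eqxx. Qed.

Lemma vunitM c d : vunit c -> vunit d -> vunit (c * d).
Proof.
move=> /andP[c0 /eqP vc] /andP[d0 /eqP vd].
by rewrite /vunit mulf_neq0 //= dvalM // vc vd addr0.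
Qed.

Lemma vunitN c : vunit (- c) = vunit c.
Proof. by rewrite /vunit oppr_eq0 dvalN. Qed.

Lemma vunitV c : vunit c -> vunit c^-1.
Proof.
move=> /andP[c0 /eqP vc]; rewrite /vunit invr_eq0 c0 /=.
have := dvalM v c0 (invr_neq0 c0).
by rewrite mulfV // dval1 vc add0r => <-.
Qed.

Lemma units_in_vint c : (c \in units_in (vint v)) = vunit c.
Proof.
apply/idP/idP => [/and3P[vc cU vci]|cU].
  have c0 : c != 0 by rewrite -unitfE.
  move: vc vci; rewrite !inE invr_eq0 (negbTE c0) /= /vunit c0 /= => vc vci.
  have := dvalM v c0 (invr_neq0 c0); rewrite mulfV // dval1; lia.
by apply/and3P; split; [exact: vunit_ge0 | rewrite unitfE vunit_neq0
  | exact: (vunit_ge0 (vunitV cU))].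
Qed.

Lemma vunit_sqr c : vunit (c ^+ 2) -> vunit c.
Proof.
rewrite /vunit sqrf_eq0; have [//|c0] /= := eqVneq c 0.
by rewrite expr2 dvalM // -mulr2n mulrn_eq0.
Qed.

Lemma vunitD c d : vunit c -> val_ge 1 d -> vunit (c + d).
Proof.
move=> cU dm; have c0 := vunit_neq0 cU; case/andP: (cU) => _ /eqP vc.
have cn1 : ~~ val_ge 1 c by rewrite /val_ge negb_or c0 vc.
have cd1 : ~~ val_ge 1 (c + d).
  by apply: contra cn1 => cd1; rewrite -(addrK d c) val_geB.
have : val_ge 0 (c + d) by apply: val_geD; [exact: vunit_ge0 | exact: val_geW dm].
move: cd1; rewrite /val_ge /vunit negb_or => /andP[/negbTE-> /=].
by rewrite -ltNge => ? ?; lia.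
Qed.

(** If [2] were not a unit it would lie in the maximal ideal, so its class would
    vanish in the residue field. *)
Lemma two_vunit : 2%N \notin [pchar residue_field v] -> vunit 2%:R.
Proof.
rewrite inE /= => char2.
have v2 : val (2%:R : val_ring v) = 2%:R by rewrite rmorphMn rmorph1.
have ge2 : val_ge 0 2%:R by rewrite -v2; exact: (valP (2%:R : val_ring v)).
suff n2 : (2%:R : val_ring v) \notin @max_ideal K v.
  move: n2 ge2; rewrite inE v2 /val_ge /vunit negb_or => /andP[/negbTE-> /=].
  by rewrite -leNgt => ? ?; lia.
apply: contra char2 => m2.
have -> : (2%:R : residue_field v) = \pi_(residue_field v)%qT 2%:R.
  by rewrite -[1]pi_oner -rmorphMn.
rewrite -[0]pi_zeror -Quotient.idealrBE subr0 //.
Qed.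

(** The root is [1 + l], where [l] is the fixed point of [c |-> (q - c^2) / 2].
    This map sends the maximal ideal to itself, and there it brings points
    closer by one power of the uniformizer, because
    [c^2 - d^2 = (c - d) (c + d)] with [c + d] in the maximal ideal. *)
Lemma hensel_sqrt : val_complete v -> vunit 2%:R ->
  forall q, val_ge 1 q -> exists2 r, r ^+ 2 = 1 + q & val_ge 1 (r - 1).
Proof.
move=> complete u2 q q1; have n2 := vunit_neq0 u2.
have half_ge n c : val_ge n c -> val_ge n (c / 2%:R).
  by move=> cn; rewrite -[n]addr0 val_geM // vunit_ge0 ?vunitV.
pose s := fix s n := if n is n'.+1 then (q - s n' ^+ 2) / 2%:R else 0.
have s1 n : val_ge 1 (s n).
  elim: n => [|n IH] /=; first exact: val_ge0.
  by rewrite half_ge ?val_geB // expr2 (@val_geW _ (1 + 1)) ?val_geM.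
have contract (n : int) c d : val_ge 1 c -> val_ge 1 d -> val_ge n (c - d) ->
    val_ge (n + 1) ((q - c ^+ 2) / 2%:R - (q - d ^+ 2) / 2%:R).
  move=> c1 d1 cd.
  have -> : (q - c ^+ 2) / 2%:R - (q - d ^+ 2) / 2%:R
      = - ((c - d) * ((c + d) / 2%:R)) by field.
  by rewrite val_geN val_geM // half_ge ?val_geD.
have step (n k : nat) : val_ge n (s (n + k)%N - s n).
  elim: n => [|n IH].
    by apply: val_geB; apply: val_geW (s1 _).
  have -> : Posz n.+1 = n%:Z + 1 by lia.
  by apply: contract (s1 _) (s1 _) IH.
have [l sl] : exists l, forall N : int, exists n0, forall n,
    (n0 <= n)%N -> val_close v N (s n) l.
  apply: complete => N; exists (absz N) => m n Nm Nn.
  suff: val_ge N (s m - s n).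
    by rewrite /val_ge subr_eq0 => /orP[/eqP|]; [left | right].
  rewrite -(subnKC Nm) -(subnKC Nn).
  have -> : s (absz N + (m - absz N))%N - s (absz N + (n - absz N))%N
      = (s (absz N + (m - absz N))%N - s (absz N))
        - (s (absz N + (n - absz N))%N - s (absz N)) by ring.
  by apply: (@val_geW _ (absz N)); [lia | apply: val_geB].
have {}sl (N : int) : exists n0, forall n, (n0 <= n)%N -> val_ge N (s n - l).
  have [n0 sn0] := sl N; exists n0 => n /sn0.
  by rewrite /val_ge => -[->|->]; rewrite ?subrr ?eqxx ?orbT.
have l1 : val_ge 1 l.
  have [n sn] := sl 1.
  by rewrite -(subKr (s n) l) val_geB // sn.
have fix_l : (q - l ^+ 2) / 2%:R - l = 0.
  apply: val_ge_eq0 => N; have [n sn] := sl N.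
  have -> : (q - l ^+ 2) / 2%:R - l
     = (s n.+1 - l) - ((q - s n ^+ 2) / 2%:R - (q - l ^+ 2) / 2%:R).
    by rewrite /=; ring.
  apply: val_geB; first by rewrite sn.
  by apply: (@val_geW _ (Posz N + 1)); [lia | rewrite contract // sn].
exists (1 + l); last by rewrite addrC addKr.
have -> : q = ((q - l ^+ 2) / 2%:R - l) * 2%:R + 2%:R * l + l ^+ 2 by field.
by rewrite fix_l; ring.
Qed.
End Valuation.

(** * Quaternion arithmetic in coordinates *)

Section Quaternion.
Variables (K : fieldType) (D : falgType K) (a b : K) (x y z : D).
Hypothesis Q : quaternion_basis a b x y z.

Definition quat c0 c1 c2 c3 : D := c0 *: 1 + c1 *: x + c2 *: y + c3 *: z.

Lemma quat_inj c0 c1 c2 c3 d0 d1 d2 d3 :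
  quat c0 c1 c2 c3 = quat d0 d1 d2 d3 -> [/\ c0 = d0, c1 = d1, c2 = d2 & c3 = d3].
Proof.
move=> E; have C i : [:: c0; c1; c2; c3]`_(i : 'I_4) = [:: d0; d1; d2; d3]`_i.
  by rewrite -!(qcoord_quat Q) -/(quat _ _ _ _) E.
by split; [exact: (C 0) | exact: (C 1) | exact: (C 2) | exact: (C 3)].
Qed.

Lemma quatD c0 c1 c2 c3 d0 d1 d2 d3 :
  quat c0 c1 c2 c3 + quat d0 d1 d2 d3
    = quat (c0 + d0) (c1 + d1) (c2 + d2) (c3 + d3).
Proof.
rewrite /quat !scalerDl.
by rewrite [LHS](AC (4*4) ((1*5)*(2*6)*(3*7)*(4*8)))/=.
Qed.

Lemma quatZ k c0 c1 c2 c3 :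
  k *: quat c0 c1 c2 c3 = quat (k * c0) (k * c1) (k * c2) (k * c3).
Proof. by rewrite /quat !scalerDr !scalerA. Qed.

Lemma quatM c0 c1 c2 c3 d0 d1 d2 d3 :
  quat c0 c1 c2 c3 * quat d0 d1 d2 d3
    = quat (c0 * d0 + a * (c1 * d1) + b * (c2 * d2) - a * b * (c3 * d3))
           (c0 * d1 + c1 * d0 - b * (c2 * d3) + b * (c3 * d2))
           (c0 * d2 + c2 * d0 + a * (c1 * d3) - a * (c3 * d1))
           (c0 * d3 + c3 * d0 + c1 * d2 - c2 * d1).
Proof.
have [xx yy zE zE' _] := Q.
have e1 : 1 = quat 1 0 0 0 by rewrite /quat !scale0r scale1r !addr0.
have ex : x = quat 0 1 0 0 by rewrite /quat !scale0r scale1r !addr0 add0r.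
have ey : y = quat 0 0 1 0 by rewrite /quat !scale0r scale1r addr0 !add0r.
have ez : z = quat 0 0 0 1 by rewrite /quat !scale0r scale1r !add0r.
have yx : y * x = (-1) *: z by rewrite scaleN1r zE' opprK.
have xz : x * z = a *: y by rewrite zE mulrA -expr2 xx mulr_algl.
have zx : z * x = (- a) *: y.
  by rewrite {1}zE -mulrA yx -scalerAr xz scalerA mulN1r.
have zy : z * y = b *: x by rewrite {1}zE -mulrA -expr2 yy mulr_algr.
have yz : y * z = (- b) *: x.
  by rewrite {1}zE mulrA yx -scalerAl zy scalerA mulN1r.
have zz : z * z = (- (a * b))%:A.
  by rewrite {1}zE -mulrA yz -scalerAr -expr2 xx scalerA mulrC mulrN.
have mZ (k l : K) (g h : D) : (k *: g) * (l *: h) = (k * l) *: (g * h).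
  by rewrite -scalerAl -scalerAr scalerA.
(* The sixteen products of basis vectors are written as quaternions again, so
   that only identities between coordinates in [K] remain. *)
rewrite {1 2}/quat !mulrDl !mulrDr !mZ -!expr2 xx yy -zE yx xz zx yz zy.
rewrite [z ^+ 2]expr2 zz !mulr1 !mul1r expr1n.
rewrite e1 ex ey ez !quatZ !quatD.
by congr quat; ring.
Qed.

Lemma quat0 : quat 0 0 0 0 = 0.
Proof. by rewrite /quat !scale0r !addr0. Qed.

Lemma quat1 : quat 1 0 0 0 = 1.
Proof. by rewrite /quat !scale0r scale1r !addr0. Qed.

Lemma quatx : quat 0 1 0 0 = x.
Proof. by rewrite /quat !scale0r scale1r !addr0 add0r. Qed.

Lemma quaty : quat 0 0 1 0 = y.
Proof. by rewrite /quat !scale0r scale1r addr0 !add0r. Qed.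

Lemma Nrd_quat c0 c1 c2 c3 :
  Nrd x y z (quat c0 c1 c2 c3)
    = c0 ^+ 2 - a * c1 ^+ 2 - b * c2 ^+ 2 + a * b * c3 ^+ 2.
Proof.
rewrite /Nrd (canonical_inv_quat Q) -/(quat _ _ _ _) quatM (qcoord_quat Q) /=.
by ring.
Qed.

(** The common shape of [tau], [tau_x] and [tau_y].  The sign of [z = x y] is
    forced by those of [x] and [y], since an involution sends [x y] to
    [s2 s1 y x = - (s1 s2) z]. *)
Definition sign_involution (s1 s2 : K) (sigma : D -> D) : Prop :=
  forall c0 c1 c2 c3, sigma (quat c0 c1 c2 c3)
    = quat c0 (s1 * c1) (s2 * c2) (- (s1 * s2) * c3).

Lemma sign_involutionM s1 s2 sigma : s1 ^+ 2 = 1 -> s2 ^+ 2 = 1 ->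
  sign_involution s1 s2 sigma -> forall d e, sigma (d * e) = sigma e * sigma d.
Proof.
move=> /eqP s1P /eqP s2P sE d e.
have [c0 [c1 [c2 [c3 ->]]]] := quat_decomp Q d; rewrite -/(quat _ _ _ _).
have [d0 [d1 [d2 [d3 ->]]]] := quat_decomp Q e; rewrite -/(quat _ _ _ _).
rewrite quatM !sE quatM.
move: s1P s2P; rewrite !sqrf_eq1 => /orP[] /eqP -> /orP[] /eqP ->;
  by congr quat; ring.
Qed.

Lemma sign_involution_linear s1 s2 sigma : sign_involution s1 s2 sigma ->
  forall (k : K) d e, sigma (k *: d + e) = k *: sigma d + sigma e.
Proof.
move=> sE k d e.
have [c0 [c1 [c2 [c3 ->]]]] := quat_decomp Q d; rewrite -/(quat _ _ _ _).
have [d0 [d1 [d2 [d3 ->]]]] := quat_decomp Q e; rewrite -/(quat _ _ _ _).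
by rewrite quatZ quatD !sE quatZ quatD; congr quat; ring.
Qed.

Lemma canonical_inv_sign : sign_involution (-1) (-1) (canonical_inv x y z).
Proof.
move=> c0 c1 c2 c3; rewrite (canonical_inv_quat Q) -/(quat _ _ _ _).
by congr quat; ring.
Qed.

Lemma twisted_inv_x_sign :
  x \is a GRing.unit -> sign_involution (-1) 1 (twisted_inv x y z x).
Proof.
move=> xU c0 c1 c2 c3; rewrite /twisted_inv canonical_inv_sign.
apply: (mulIr xU); rewrite mulrVK // -[X in X * _ = _ * X]quatx !quatM.
by congr quat; ring.
Qed.

Lemma twisted_inv_y_sign :
  y \is a GRing.unit -> sign_involution 1 (-1) (twisted_inv x y z y).
Proof.
move=> yU c0 c1 c2 c3; rewrite /twisted_inv canonical_inv_sign.
apply: (mulIr yU); rewrite mulrVK // -[X in X * _ = _ * X]quaty !quatM.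
by congr quat; ring.
Qed.

End Quaternion.

(** * Isometry onto the component in [K(x)] *)

Section SquareRoot.
Variables (K : fieldType) (D : falgType K) (sigma : D -> D).
Hypothesis sigma1 : sigma 1 = 1.
Hypothesis sigmaM : forall d e, sigma (d * e) = sigma e * sigma d.
Hypothesis sigma_linear :
  forall (k : K) d e, sigma (k *: d + e) = k *: sigma d + sigma e.

(** With [e^2 = q], the equation on [rho] says that [t = rho + e / (2 rho)]
    satisfies [t^2 = 1 + e].  The two conditions on [e] make
    [sigma t * u0 = u0 * t], hence [sigma t * u0 * t = u0 * (1 + e) = u0 + w]. *)
Lemma isometric_mul_sqrt (u0 w e : D) (q rho : K) :
    division_algebra D -> u0 + w != 0 ->
    u0 * e = w -> sigma e * u0 = w -> e ^+ 2 = q%:A ->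
    2%:R != 0 :> K -> rho != 0 -> rho ^+ 2 + q / (2%:R * rho) ^+ 2 = 1 ->
  isometric (herm1 sigma (u0 + w)) (herm1 sigma u0).
Proof.
move=> div u0w ue se ee n2 rho0 rhoE.
pose kappa := (2%:R * rho)^-1; pose t := kappa *: e + rho *: 1.
have st : sigma t * u0 = u0 * t.
  have sr : sigma (rho *: 1) = rho *: 1.
    have s0 : sigma 0 = 0.
      have := sigma_linear 1 0 0; rewrite !scale1r addr0 => /eqP.
      by rewrite -[X in X == _]addr0 (inj_eq (addrI _)) eq_sym => /eqP.
    by rewrite -[rho *: 1]addr0 sigma_linear sigma1 s0.
  rewrite sigma_linear sr mulrDl mulrDr -!scalerAl -!scalerAr se ue.
  by rewrite mul1r mulr1.
have tt : t * t = 1 + e.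
  rewrite mulrDl !mulrDr -!scalerAl -!scalerAr !mulr1 !mul1r -expr2 ee.
  rewrite !scalerA.
  rewrite addrA [LHS](AC 4 ((4*1)*(2*3)))/= -!scalerDl.
  congr (_ + _); last first.
    have -> : kappa * rho + rho * kappa = 1 by rewrite /kappa; field; apply/andP.
    by rewrite scale1r.
  rewrite -{2}[1]scale1r -rhoE; congr (_ *: _); rewrite /kappa; field.
  by apply/andP.
have uE : u0 + w = sigma t * u0 * t by rewrite st -mulrA tt mulrDr mulr1 ue.
apply/isometric_herm1 => //; exists t => //.
by apply: div; apply: contraNneq u0w => t0; rewrite uE t0 mulr0.
Qed.

End SquareRoot.

Section Unramified.
Variables (K : fieldType) (v : discrete_valuation K).
Hypothesis v_complete : val_complete v.
Hypothesis two_unit : vunit v 2%:R.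
Variables (pi a : K) (D : falgType K) (x y z : D).
Hypothesis pi_unif : uniformizer v pi.
Hypothesis a_int : a \in vint v.
Hypothesis div : division_algebra D.
Hypothesis Q : quaternion_basis a pi x y z.
Local Notation quat := (quat x y z).

Lemma val_ge1_Kxy_norm (beta gamma : K) : beta \in vint v -> gamma \in vint v ->
  val_ge v 1 (pi * (beta ^+ 2 - a * gamma ^+ 2)).
Proof.
move=> bint cint; have pi1 : val_ge v 1 pi.
  by case: pi_unif => _ vpi; rewrite /val_ge vpi lexx orbT.
rewrite -[X in val_ge v X _]addr0 val_geM //.
by rewrite -[val_ge v 0 _]/(_ \in vint v) rpredB ?rpredM ?rpredX.
Qed.

(** The reduced norms of the component in [K(x)] and of [u] differ by an
    element of the maximal ideal. *)
Lemma vunit_Kx_norm (delta alpha beta gamma : K) :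
    beta \in vint v -> gamma \in vint v ->
  vunit v (Nrd x y z (quat delta alpha beta gamma)) ->
  vunit v (delta ^+ 2 - a * alpha ^+ 2).
Proof.
move=> bint cint; rewrite (Nrd_quat Q) => /vunitD /(_ (val_ge1_Kxy_norm bint cint)).
by congr (vunit v _); ring.
Qed.

(** If [n^2 = 1 - q] and [rho^2 = (1 + n) / 2], then
    [q / (4 rho^2) = (1 - n^2) / (2 (1 + n)) = (1 - n) / 2].  Taking [n] close to
    [1] makes [(1 + n) / 2] close to [1], so that both square roots exist. *)
Lemma square_root_coefficient q : val_ge v 1 q ->
  exists2 rho, rho != 0 & rho ^+ 2 + q / (2%:R * rho) ^+ 2 = 1.
Proof.
move=> q1; have n2 := vunit_neq0 two_unit.
have [|n nE n1] := hensel_sqrt v_complete two_unit (q := - q).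
  by rewrite val_geN.
have h1 : val_ge v 1 ((n - 1) / 2%:R).
  by rewrite -[1]addr0 val_geM // vunit_ge0 ?vunitV.
have [rho rhoE _] := hensel_sqrt v_complete two_unit h1.
have rho_unit := vunitD (vunit1 v) h1.
have qE : q = 1 - n ^+ 2 by rewrite nE opprD opprK addrA subrr add0r.
have rhoE' : rho ^+ 2 = (1 + n) / 2%:R by rewrite rhoE; field.
have rho0 : rho != 0.
  by rewrite -(@sqrf_eq0 _ rho) rhoE (vunit_neq0 rho_unit).
have n10 : 1 + n != 0.
  by apply: contra_neq rho0 => n0; apply/eqP; rewrite -sqrf_eq0 rhoE' n0 mul0r.
have n4 : 4%:R != 0 :> K by rewrite (natrM _ 2 2) mulf_neq0.
by exists rho => //; rewrite exprMn rhoE' qE; field; rewrite n10 n2 n4.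
Qed.

Variables (s1 s2 : K) (sigma : D -> D).
Hypothesis s1_sqr : s1 ^+ 2 = 1.
Hypothesis s2_sqr : s2 ^+ 2 = 1.
Hypothesis sigmaE : sign_involution x y z s1 s2 sigma.

(** Here [e = u0^-1 w] satisfies [sigma e * u0 = w] because [sigma] multiplies
    [u0], [w] and hence [u0 * e] by the same nonzero scalar [epsilon]. *)
Lemma isometric_Kx_component (epsilon delta alpha beta gamma : K) :
    epsilon != 0 -> beta \in vint v -> gamma \in vint v ->
    sigma (quat delta alpha beta gamma)
      = epsilon *: quat delta alpha beta gamma ->
    vunit v (Nrd x y z (quat delta alpha beta gamma)) ->
  isometric (herm1 sigma (quat delta alpha beta gamma))
            (herm1 sigma (quat delta alpha 0 0)).
Proof.
move=> eps0 bint cint sym Nu.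
have N0 := vunit_Kx_norm bint cint Nu; have n0 := vunit_neq0 N0.
set n := delta ^+ 2 - a * alpha ^+ 2 in N0 n0.
(* The coordinates of [u0^-1 w], as [u0^-1 = (delta - alpha x) / n]. *)
pose e := quat 0 0 ((delta * beta - a * alpha * gamma) / n)
                   ((delta * gamma - alpha * beta) / n).
pose q := pi * (beta ^+ 2 - a * gamma ^+ 2) / n.
have q1 : val_ge v 1 q.
  rewrite -[X in val_ge v X _]addr0 val_geM ?val_ge1_Kxy_norm //.
  exact/vunit_ge0/vunitV.
have [rho rho0 rhoE] := square_root_coefficient q1.
pose w := quat 0 0 beta gamma.
have uE : quat delta alpha beta gamma = quat delta alpha 0 0 + w.
  by rewrite quatD !addr0 !add0r.
have ue : quat delta alpha 0 0 * e = w.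
  by rewrite (quatM Q); congr quat; rewrite /n; field.
have ee : e ^+ 2 = q%:A.
  rewrite expr2 (quatM Q) -(quat1 x y z) quatZ.
  by congr quat; rewrite /q /n; field.
have sM := sign_involutionM Q s1_sqr s2_sqr sigmaE.
(* [sigma] acts by signs on the basis, so [u0] and [w] inherit the symmetry of
   [u]. *)
have [s0 sw] : sigma (quat delta alpha 0 0) = epsilon *: quat delta alpha 0 0
    /\ sigma w = epsilon *: w.
  move: sym; rewrite /w !sigmaE !quatZ => /(quat_inj Q)[<- <- <- <-].
  by rewrite !mulr0.
have se : sigma e * quat delta alpha 0 0 = w.
  apply: (scalerI eps0); rewrite -sw -ue sM s0.
  by rewrite -scalerAr.
rewrite uE; apply: (isometric_mul_sqrt _ sM _ div _ ue se ee _ rho0 rhoE).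
- by rewrite -(quat1 x y z) sigmaE !mulr0.
- exact: (sign_involution_linear Q sigmaE).
- rewrite -uE; apply: contraTneq Nu => ->.
  by rewrite -(quat0 x y z) (Nrd_quat Q) /vunit !expr0n /= !mulr0 !subr0 addr0 eqxx.
- exact: (vunit_neq0 two_unit).
Qed.

End Unramified.

(** * Units of [K(x)] *)

Section KxUnits.
Variables (K : fieldType) (v : discrete_valuation K).
Variables (b a : K) (D : falgType K) (x y z : D).
Hypothesis Q : quaternion_basis a b x y z.

(** As the value of [v] at [0] is arbitrary, [Nrd d != 0] does not follow from
    the valuation; it holds because [d * canonical_inv d = Nrd d] in a division
    algebra. *)
Lemma vunit_Nrd d : d != 0 -> division_algebra D ->
  nuD x y z v d = 0 -> vunit v (Nrd x y z d).
Proof.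
move=> d0 div /eqP; rewrite /nuD mulf_eq0 invr_eq0 pnatr_eq0 orbF intr_eq0.
move=> vN; rewrite /vunit vN andbT; apply/eqP => N0.
have conj0 : canonical_inv x y z d = 0.
  by apply: (mulrI (div _ d0)); rewrite mulr0 (canonical_inv_norm Q) N0 scale0r.
have [c0 [c1 [c2 [c3 dE]]]] := quat_decomp Q d; case/eqP: d0; move: conj0.
rewrite {}dE (canonical_inv_quat Q) -!/(quat x y z _ _ _ _) -(quat0 x y z).
move=> /(quat_inj Q)[-> /eqP + /eqP + /eqP]; rewrite !oppr_eq0.
by move=> /eqP-> /eqP-> /eqP->.
Qed.

(** The inverse of [delta + alpha x] is [(delta - alpha x) / n], whose norm is
    [n^-1], where [n = delta^2 - a alpha^2]. *)
Lemma Kx_unit delta alpha : vunit v (delta ^+ 2 - a * alpha ^+ 2) ->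
  quat x y z delta alpha 0 0 \in units_in (Kx_vint x y z v).
Proof.
move=> nU; have n0 := vunit_neq0 nU; set n := _ - _ in nU n0.
have KxP c0 c1 : vunit v (c0 ^+ 2 - a * c1 ^+ 2) ->
    quat x y z c0 c1 0 0 \in Kx_vint x y z v.
  move=> /andP[_ /eqP vN]; apply/andP; split.
    rewrite /quat !scale0r !addr0.
    apply: memvD; apply: memvZ; first by apply: subvP_adjoin; exact: memv_line.
    exact: memv_adjoin.
  apply/orP; right; rewrite /nuD (Nrd_quat Q).
  rewrite [X in v X](_ : _ = c0 ^+ 2 - a * c1 ^+ 2) ?vN ?mul0r //; ring.
pose w := quat x y z (delta / n) (- alpha / n) 0 0.
have uw : quat x y z delta alpha 0 0 * w = 1.
  by rewrite (quatM Q) -(quat1 x y z); congr quat; rewrite /n; field.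
have wu : w * quat x y z delta alpha 0 0 = 1.
  by rewrite (quatM Q) -(quat1 x y z); congr quat; rewrite /n; field.
have uU : quat x y z delta alpha 0 0 \is a GRing.unit by apply/unitrP; exists w.
apply/and3P; split; [exact: KxP | by [] |].
have -> : (quat x y z delta alpha 0 0)^-1 = w.
  by apply: (mulrI uU); rewrite mulrV // uw.
apply: KxP; suff -> : (delta / n) ^+ 2 - a * (- alpha / n) ^+ 2 = n^-1.
  exact: vunitV.
by rewrite /n; field.
Qed.
End KxUnits.

(** * The classification *)

Theorem mainTheorem4 (K : fieldType) (v : discrete_valuation K)
    (K_complete : val_complete v)
    (residue_char : 2%N \notin [pchar (residue_field v)])
    (pi : K) (pi_unif : uniformizer v pi)
    (a : K) (a_unit : a \in units_in (vint v))
    (D : falgType K) (D_division : division_algebra D)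
    (x y z : D) (Dxyz : quaternion_basis a pi x y z)
    (sigma : D -> D)
    (sigma_cases : [\/ sigma =1 canonical_inv x y z,
                       sigma =1 twisted_inv x y z x
                     | sigma =1 twisted_inv x y z y])
    (epsilon : K) (epsilon_cases : epsilon = 1 \/ epsilon = -1)
    (delta alpha beta gamma : K)
    (delta_int : delta \in vint v) (alpha_int : alpha \in vint v)
    (beta_int : beta \in vint v) (gamma_int : gamma \in vint v)
    (u : D)
    (u_def : u = delta%:A + alpha *: x + beta *: y + gamma *: z)
    (u_sym : sigma u = epsilon *: u)
    (u_neq0 : u != 0) (u_val : nuD x y z v u = 0) :
  let h := herm1 sigma u in
  [/\ sigma =1 canonical_inv x y z -> epsilon = 1 ->
        isometric h (herm1 sigma delta%:A) /\ delta \in units_in (vint v),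
      sigma =1 canonical_inv x y z -> epsilon = -1 ->
        isometric h (herm1 sigma (alpha *: x)) /\ alpha \in units_in (vint v),
      sigma =1 twisted_inv x y z x -> epsilon = 1 ->
        isometric h (herm1 sigma delta%:A) /\ delta \in units_in (vint v),
      sigma =1 twisted_inv x y z x -> epsilon = -1 ->
        isometric h (herm1 sigma (alpha *: x)) /\ alpha \in units_in (vint v)
    & sigma =1 twisted_inv x y z y ->
        [/\ epsilon = 1,
            isometric h (herm1 sigma (delta%:A + alpha *: x))
          & delta%:A + alpha *: x \in units_in (Kx_vint x y z v)]].
Proof.
move=> h; have u2 := two_vunit residue_char.
have n2 := vunit_neq0 u2; have /andP[a_int _] := a_unit.
have eps0 : epsilon != 0.
  by case: epsilon_cases => ->; rewrite ?oppr_eq0 oner_neq0.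
have Nu := vunit_Nrd Dxyz u_neq0 D_division u_val.
have quat_u : u = quat x y z delta alpha beta gamma by [].
rewrite /h {}quat_u in u_sym Nu *.
have N0 := vunit_Kx_norm pi_unif a_int Dxyz beta_int gamma_int Nu.
have sqrN1 : (- 1) ^+ 2 = 1 :> K by rewrite sqrrN expr1n.
have sqr1 : 1 ^+ 2 = 1 :> K by rewrite expr1n.
have opp_id (c : K) : - c = c -> c = 0.
  move=> /eqP; rewrite -subr_eq0 -opprD oppr_eq0 -mulr2n -mulr_natl mulf_eq0.
  by rewrite (negbTE n2) => /eqP.
have diagonalize s1 s2 : s1 ^+ 2 = 1 -> s2 ^+ 2 = 1 ->
    sign_involution x y z s1 s2 sigma ->
    [/\ isometric (herm1 sigma (quat x y z delta alpha beta gamma))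
                  (herm1 sigma (quat x y z delta alpha 0 0)),
        delta = epsilon * delta & s1 * alpha = epsilon * alpha].
  move=> s1P s2P sE; have iso := isometric_Kx_component K_complete u2 pi_unif a_int
    D_division Dxyz s1P s2P sE eps0 beta_int gamma_int u_sym Nu.
  by move: u_sym; rewrite sE quatZ => /(quat_inj Dxyz)[].
have delta_case : alpha = 0 ->
    isometric (herm1 sigma (quat x y z delta alpha beta gamma))
              (herm1 sigma (quat x y z delta alpha 0 0)) ->
    isometric (herm1 sigma (quat x y z delta alpha beta gamma))
              (herm1 sigma delta%:A) /\ delta \in units_in (vint v).
  move=> al0; have <- : quat x y z delta alpha 0 0 = delta%:A.
    by rewrite /quat al0 !scale0r !addr0.
  move=> ?; split=> //; move: N0; rewrite al0 expr0n mulr0 subr0.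
  by rewrite units_in_vint; exact: vunit_sqr.
have alpha_case : delta = 0 ->
    isometric (herm1 sigma (quat x y z delta alpha beta gamma))
              (herm1 sigma (quat x y z delta alpha 0 0)) ->
    isometric (herm1 sigma (quat x y z delta alpha beta gamma))
              (herm1 sigma (alpha *: x)) /\ alpha \in units_in (vint v).
  move=> de0; have <- : quat x y z delta alpha 0 0 = alpha *: x.
    by rewrite /quat de0 !scale0r !addr0 add0r.
  move=> ?; split=> //; rewrite units_in_vint; apply: vunit_sqr.
  move: a_unit; rewrite units_in_vint => aU.
  have -> : alpha ^+ 2 = - a^-1 * (delta ^+ 2 - a * alpha ^+ 2).
    by rewrite de0; field; exact: vunit_neq0 aU.
  by rewrite vunitM // vunitN vunitV.
have a0 : a != 0 by case/and3P: a_unit => _; rewrite unitfE.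
have [xx yy _ _ _] := Dxyz.
have sqr_unit (c : K) (d : D) : c != 0 -> d ^+ 2 = c%:A -> d \is a GRing.unit.
  move=> c0 dd; apply: D_division; apply: contra_neq c0 => d0.
  by move/eqP: dd; rewrite d0 expr0n eq_sym scaler_eq0 oner_eq0 orbF => /eqP.
have tau_x_sign := twisted_inv_x_sign Dxyz (sqr_unit _ _ a0 xx).
have tau_y_sign := twisted_inv_y_sign Dxyz (sqr_unit _ _ (proj1 pi_unif) yy).
split=> sE.
- move=> e1; have [c0 c1 c2 c3|iso _ al] := diagonalize (-1) (-1) sqrN1 sqrN1.
    by rewrite sE (canonical_inv_sign Dxyz).
  by apply: delta_case => //; apply: opp_id; rewrite -mulN1r al e1 mul1r.
- move=> e1; have [c0 c1 c2 c3|iso de _] := diagonalize (-1) (-1) sqrN1 sqrN1.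
    by rewrite sE (canonical_inv_sign Dxyz).
  by apply: alpha_case => //; apply: opp_id; rewrite {2}de e1 mulN1r.
- move=> e1; have [c0 c1 c2 c3|iso _ al] := diagonalize (-1) 1 sqrN1 sqr1.
    by rewrite sE tau_x_sign.
  by apply: delta_case => //; apply: opp_id; rewrite -mulN1r al e1 mul1r.
- move=> e1; have [c0 c1 c2 c3|iso de _] := diagonalize (-1) 1 sqrN1 sqr1.
    by rewrite sE tau_x_sign.
  by apply: alpha_case => //; apply: opp_id; rewrite {2}de e1 mulN1r.
have [c0 c1 c2 c3|iso de al] := diagonalize 1 (-1) sqr1 sqrN1.
  by rewrite sE tau_y_sign.
have KxE : quat x y z delta alpha 0 0 = delta%:A + alpha *: x.
  by rewrite /quat !scale0r !addr0.
rewrite -KxE; split=> //; last exact: Kx_unit Dxyz _ _ N0.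
(* For [epsilon = -1] both [delta] and [alpha] vanish, so [u] lies in [K(x) y]
   and its reduced norm cannot be a unit. *)
case: epsilon_cases => // e1; case/eqP: (vunit_neq0 N0).
move: de al; rewrite e1 !mulN1r mul1r => /esym/opp_id -> /esym/opp_id ->.
by rewrite !expr0n mulr0 subr0.
Qed.
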